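(* Suppose that $(X,\mathcal{E})$ and $(Y,\mathcal{F})$ are uniformly locally finite coarse spaces and that there exists an isomorphism $\Phi\colon \mathrm{C}^*_u(X)\to \mathrm{C}^*_u(Y)$ which is not rigidly implemented. Then at least one of the following applies. (i) There is a non-compact projection $P\in\ell_\infty(X)$ such that $\Phi(P)$ is a ghost in $\mathrm{C}^*_u(Y)$. (ii) There is a non-compact projection $P\in\ell_\infty(Y)$ such that $\Phi^{-1}(P)$ is a ghost in $\mathrm{C}^*_u(X)$.
   Context: Coarse structures. A coarse structure on a set $X$ is a collection $\mathcal{E}$ of subsets of $X\times X$ (called entourages) which contains the diagonal $\Delta_X=\{(x,x): x\in X\}$ and is closed under taking subsets, inverses $E^{-1}=\{(x,y):(y,x)\in E\}$, finite unions, and compositions $E\circ F=\{(x,y): \exists z\ (x,z)\in E,\ (z,y)\in F\}$; $(X,\mathcal{E})$ is a coarse space. It is uniformly locally finite if $\sup_{x\in X}|\{y\in X:(x,y)\in E\}|<\infty$ for all $E\in\mathcal{E}$. Uniform Roe algebras. For $T\in B(\ell_2(X))$ let $\mathrm{supp}(T)=\{(x,x'):\langle T\delta_x,\delta_{x'}\rangle\ne 0\}$. The uniform Roe algebra $\mathrm{C}^*_u(X)$ is the norm closure in $B(\ell_2(X))$ of $\{T\in B(\ell_2(X)): \mathrm{supp}(T)\in\mathcal{E}\}$. $\ell_\infty(X)$ is identified with the operators whose support is contained in $\Delta_X$, so $\ell_\infty(X)\subset \mathrm{C}^*_u(X)$. Isomorphisms of C*-algebras are $*$-isomorphisms. An isomorphism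 $\Phi\colon \mathrm{C}^*_u(X)\to \mathrm{C}^*_u(Y)$ is rigidly implemented (is a rigid isomorphism) if there is a unitary $U\colon\ell_2(X)\to\ell_2(Y)$ with $\Phi(T)=UTU^*$ for all $T$, $\inf_{x\in X}\sup_{y\in Y}|\langle U\delta_x,\delta_y\rangle|>0$ and $\inf_{y\in Y}\sup_{x\in X}|\langle U^*\delta_y,\delta_x\rangle|>0$. An operator $T\in \mathrm{C}^*_u(X)$ is a ghost if for all $\varepsilon>0$ there is a finite $A\subset X$ such that $|\langle T\delta_x,\delta_{x'}\rangle|<\varepsilon$ for all $x,x'\in X\setminus A$. *)

(* Defs.v *)
From HB Require Import structures.
From mathcomp Require Import all_boot all_order all_algebra.
From mathcomp Require Import all_classical all_reals all_analysis.
From mathcomp Require Export complex.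
From mathcomp Require summability.
From mathcomp Require Import ring lra.

Set Implicit Arguments.
Unset Strict Implicit.
Unset Printing Implicit Defensive.

Import Order.TTheory GRing.Theory Num.Theory numFieldNormedType.Exports.

Local Open Scope classical_set_scope.
Local Open Scope complex_scope.
Local Open Scope ring_scope.

(* In a normed space over R[i] the library norm `|v| is an element of R[i];
   it is always the image of a nonnegative real, which is recovered here. *)
Definition rnorm (R : realType) (V : normedZmodType R[i]) (v : V) : R :=
  complex.Re `|v|.

Section rnorm.
Context (R : realType) (V : normedZmodType R[i]).
Implicit Types (u v : V).

Lemma normE v : `|v| = (rnorm v)%:C.
Proof.
have := normr_ge0 v; rewrite lecE /= => /andP[/eqP im0 _].
by rewrite /rnorm; move: im0; case: `|v| => a b /= ->.
Qed.

Lemma rnorm_ge0 v : 0 <= rnorm v.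
Proof. by rewrite -ler0c -normE. Qed.

Lemma rnormD u v : rnorm (u + v) <= rnorm u + rnorm v.
Proof.
by rewrite -lecR [X in _ <= X]rmorphD /= -!normE ler_normD.
Qed.

Lemma rnormB u v : rnorm (u - v) = rnorm (v - u).
Proof. by rewrite /rnorm distrC. Qed.

Lemma rnorm0 : rnorm (0 : V) = 0.
Proof. by rewrite /rnorm normr0. Qed.

Lemma rnorm0_eq0 v : rnorm v = 0 -> v = 0.
Proof. by move=> v0; apply/normr0_eq0; rewrite normE v0. Qed.

End rnorm.

Lemma rnormM (R : realType) (a b : R[i]) : rnorm (a * b) = rnorm a * rnorm b.
Proof. by apply/complexI; rewrite rmorphM /= -!normE normrM. Qed.

Lemma rnormZ (R : realType) (V : normedModType R[i]) (a : R[i]) (v : V) :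
  rnorm (a *: v) = rnorm a * rnorm v.
Proof. by apply/complexI; rewrite rmorphM /= -!normE normrZ. Qed.

Section sqsum.
Context (R : realType) (X : choiceType).
Implicit Types (u v : X -> R[i]).

Definition sqsum u : \bar R := \esum_(x in [set: X]) (rnorm (u x) ^+ 2)%:E.

Lemma sqsum_ge0 u : (0 <= sqsum u)%E.
Proof. by apply: esum_ge0 => x _; rewrite lee_fin sqr_ge0. Qed.

Lemma esumZ_le (c : R) (f : X -> \bar R) : (0 <= c)%R ->
  (forall x, 0 <= f x)%E ->
  (\esum_(x in [set: X]) (c%:E * f x) <= c%:E * \esum_(x in [set: X]) f x)%E.
Proof.
move=> c0 f0; apply: ge_ereal_sup => _ [A [finA _] <-].
rewrite -ge0_mule_fsumr//; apply: lee_wpmul2l; first by rewrite lee_fin.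
by apply: ereal_sup_ubound; exists A.
Qed.

Lemma sqsumZ_le (a : R[i]) u :
  (sqsum (a *: u) <= (rnorm a ^+ 2)%:E * sqsum u)%E.
Proof.
apply: (@le_trans _ _
    (\esum_(x in [set: X]) ((rnorm a ^+ 2)%:E * (rnorm (u x) ^+ 2)%:E))%E).
  by apply: le_esum => x _ /=; rewrite -EFinM -exprMn -rnormM.
by apply: esumZ_le => [|x]; rewrite ?lee_fin sqr_ge0.
Qed.

(* For p, q > 0 the weighted inequality below, summed over X, yields both
   stability under addition and, with p = ||u||, q = ||v||, the triangle
   inequality. *)
Lemma sqsumD_le u v (p q : R) : 0 < p -> 0 < q ->
  (sqsum (u + v)%R <=
     (1 + q / p)%:E * sqsum u + (1 + p / q)%:E * sqsum v)%E.
Proof.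
move=> p0 q0.
have pq0 : 0 <= 1 + p / q by rewrite addr_ge0// divr_ge0// ltW.
have qp0 : 0 <= 1 + q / p by rewrite addr_ge0// divr_ge0// ltW.
apply: (@le_trans _ _ (\esum_(x in [set: X])
  ((1 + q / p)%:E * (rnorm (u x) ^+ 2)%:E +
   (1 + p / q)%:E * (rnorm (v x) ^+ 2)%:E))%E).
  apply: le_esum => x _; rewrite -!EFinM -EFinD lee_fin.
  set a := rnorm (u x); set b := rnorm (v x).
  have ab : rnorm ((u + v) x) ^+ 2 <= (a + b) ^+ 2.
    by rewrite lerXn2r ?nnegrE ?rnorm_ge0 ?addr_ge0 ?rnorm_ge0 ?rnormD.
  apply: le_trans ab _; rewrite -subr_ge0.
  have -> : (1 + q / p) * a ^+ 2 + (1 + p / q) * b ^+ 2 - (a + b) ^+ 2 =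
            (q * a - p * b) ^+ 2 / (p * q).
    by field; rewrite !gt_eqF.
  by rewrite divr_ge0 ?sqr_ge0// mulr_ge0// ltW.
rewrite esumD; last 2 first.
- by move=> x _; rewrite mule_ge0 ?lee_fin// sqr_ge0.
- by move=> x _; rewrite mule_ge0 ?lee_fin// sqr_ge0.
by apply: leeD; apply: esumZ_le => // x; rewrite lee_fin sqr_ge0.
Qed.

Definition sqsummable : {pred X -> R[i]} := [pred u | (sqsum u < +oo)%E].

Lemma sqsum0 : sqsum 0 = 0%E.
Proof. by apply: esum1 => x _; rewrite rnorm0 expr0n. Qed.

Lemma sqsummable_submod_closed : submod_closed sqsummable.
Proof.
split; first by rewrite inE sqsum0 ltry.
move=> a u v /[!inE] uy vy.
apply: le_lt_trans (@sqsumD_le _ _ 1 1 ltr01 ltr01) _.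
have Zy (c : R) (w : X -> R[i]) : 0 <= c -> (sqsum w < +oo)%E ->
    (c%:E * sqsum w < +oo)%E.
  by move=> c0 wy; apply: lte_mul_pinfty.
by apply: lte_add_pinfty; apply/Zy => //;
   apply: le_lt_trans (sqsumZ_le _ _) _; apply/Zy; rewrite ?sqr_ge0.
Qed.

HB.instance Definition _ :=
  GRing.isSubmodClosed.Build _ _ sqsummable sqsummable_submod_closed.

End sqsum.

Section ell2.
Context (R : realType) (X : choiceType).

Record ell2 := Ell2 { ell2_fun :> X -> R[i]; _ : ell2_fun \in @sqsummable R X }.

HB.instance Definition _ := [isSub for ell2_fun].
HB.instance Definition _ := [Choice of ell2 by <:].
HB.instance Definition _ := [SubChoice_isSubLmodule of ell2 by <:].

Implicit Types (u v : ell2).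

Lemma ell2P u : (sqsum u < +oo)%E.
Proof. by have := valP u; rewrite inE. Qed.

Definition ell2_norm u : R := Num.sqrt (fine (sqsum u)).

Lemma ell2_normK u : ((ell2_norm u ^+ 2)%:E = sqsum u)%E.
Proof.
rewrite /ell2_norm sqr_sqrtr ?fine_ge0 ?sqsum_ge0//.
by rewrite fineK// ge0_fin_numE ?ell2P ?sqsum_ge0.
Qed.

Lemma ell2_norm0_eq0 u : ell2_norm u = 0 -> u = 0.
Proof.
move=> u0; apply/val_inj/funext => x /=; apply/rnorm0_eq0/eqP.
rewrite -sqrf_eq0 eq_le sqr_ge0 andbT -lee_fin.
suff : ((rnorm (u x) ^+ 2)%:E <= sqsum u)%E by rewrite -ell2_normK u0 expr0n.
apply: esum_ge; exists [set x]; first by split => //; exact: finite_set1.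
by rewrite fsbig_set1.
Qed.

Lemma ell2_normZ (a : R[i]) u : ell2_norm (a *: u) = rnorm a * ell2_norm u.
Proof.
have le b v : ell2_norm (b *: v) <= rnorm b * ell2_norm v.
  rewrite -(@ler_pXn2r _ 2) ?nnegrE ?mulr_ge0 ?sqrtr_ge0 ?rnorm_ge0//.
  by rewrite -lee_fin ell2_normK exprMn EFinM ell2_normK sqsumZ_le.
apply/eqP; rewrite eq_le le /=.
have [->|a0] := eqVneq a 0; first by rewrite rnorm0 mul0r sqrtr_ge0.
have ra0 : 0 < rnorm a.
  rewrite lt_def rnorm_ge0 andbT; apply: contra_neq a0; exact: rnorm0_eq0.
rewrite -ler_pdivlMl//.
have -> : (rnorm a)^-1 = rnorm a^-1.
  apply: (mulfI (lt0r_neq0 ra0)); rewrite -rnormM !divff ?(lt0r_neq0 ra0)//.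
  by rewrite /rnorm normr1.
by have := le a^-1 (a *: u); rewrite scalerA mulVf// scale1r.
Qed.

Lemma ell2_normD u v : ell2_norm (u + v) <= ell2_norm u + ell2_norm v.
Proof.
have [/ell2_norm0_eq0->|u0] := eqVneq (ell2_norm u) 0.
  by rewrite add0r lerDr sqrtr_ge0.
have [/ell2_norm0_eq0->|v0] := eqVneq (ell2_norm v) 0.
  by rewrite addr0 lerDl sqrtr_ge0.
have {}u0 : 0 < ell2_norm u by rewrite lt_def u0 sqrtr_ge0.
have {}v0 : 0 < ell2_norm v by rewrite lt_def v0 sqrtr_ge0.
rewrite -(@ler_pXn2r _ 2) ?nnegrE ?addr_ge0 ?sqrtr_ge0//.
rewrite -lee_fin ell2_normK.
apply: le_trans (sqsumD_le _ _ u0 v0) _.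
rewrite -!ell2_normK -!EFinM -EFinD lee_fin le_eqVlt; apply/orP; left.
by apply/eqP; field; rewrite !gt_eqF.
Qed.

Let norm u : R[i] := (ell2_norm u)%:C.

Let normD u v : norm (u + v) <= norm u + norm v.
Proof. by rewrite /norm -rmorphD lecR ell2_normD. Qed.

Let normZ (a : R[i]) u : norm (a *: u) = `|a| * norm u.
Proof. by rewrite /norm normE -rmorphM ell2_normZ. Qed.

Let norm_eq0 u : norm u = 0 -> u = 0.
Proof. by move=> /complexI/ell2_norm0_eq0. Qed.

HB.instance Definition _ :=
  Lmodule_isNormed.Build R[i] ell2 normD normZ norm_eq0.

(* The sum is the library's unconditional one: the limit of the partial sums
   along the finite subsets of X. *)
Definition ell2_dot u v : R[i] :=
  summability.sum (fun x => u x * (v x)^* : R[i]^o).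

Definition dirac_fun (x : X) : X -> R[i] := fun y => (y == x)%:R.

Lemma ell2_delta_sqsummable x : dirac_fun x \in @sqsummable R X.
Proof.
rewrite inE; apply: (@le_lt_trans _ _ 1%E); last exact: ltry.
rewrite /sqsum (esumID [set x]); last first.
  by move=> y _; rewrite lee_fin sqr_ge0.
rewrite [X in (_ + X)%E]esum1; last first.
  by move=> y [_ /eqP/negPf yx]; rewrite /dirac_fun yx rnorm0 expr0n.
rewrite adde0 setTI esum_set1; last by rewrite lee_fin sqr_ge0.
by rewrite /dirac_fun eqxx /rnorm normr1 expr1n.
Qed.

Definition ell2_delta (x : X) : ell2 := Ell2 (ell2_delta_sqsummable x).

End ell2.

Section boundedOp.
Context (R : realType) (V W : normedModType R[i]).

Definition continuous_linear : {pred V -> W} :=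
  [pred f | `[< linear f /\ continuous f >]].

Lemma continuous_linear_submod_closed : submod_closed continuous_linear.
Proof.
split.
  apply/asboolP; split; last exact: cst_continuous.
  by move=> a u v; rewrite /= scaler0 addr0.
move=> a f g /asboolP[linf cf] /asboolP[ling cg].
apply/asboolP; split=> [b u v|v].
  have E w : (a *: f + g) w = a *: f w + g w by [].
  rewrite !E linf ling !scalerDr !scalerA (mulrC a) -!addrA; congr (_ + _).
  by rewrite addrCA.
by apply: (@cvgD _ _ _ (nbhs v)); [apply: cvgZr; exact: cf|exact: cg].
Qed.

HB.instance Definition _ := GRing.isSubmodClosed.Build _ _ continuous_linear
  continuous_linear_submod_closed.

Record boundedOp := BoundedOp {
  boundedOp_fun :> V -> W; _ : boundedOp_fun \in continuous_linear }.

HB.instance Definition _ := [isSub for boundedOp_fun].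
HB.instance Definition _ := [Choice of boundedOp by <:].
HB.instance Definition _ := [SubChoice_isSubLmodule of boundedOp by <:].

Implicit Types (S T : boundedOp).

Lemma boundedOp_linear T : linear T.
Proof. by have := valP T => /asboolP[]. Qed.

HB.instance Definition _ T :=
  GRing.isLinear.Build R[i] V W *:%R T (boundedOp_linear T).

Lemma boundedOp_continuous T : continuous T.
Proof. by have := valP T => /asboolP[]. Qed.

Lemma boundedOp_bounded T :
  exists2 M : R, 0 <= M & forall v, rnorm (T v) <= M * rnorm v.
Proof.
have /linear_boundedP/pinfty_ex_gt0[M M0 TM] :=
  (linear_bounded_continuous T).2 (@boundedOp_continuous T).
have ME : M = (rnorm M)%:C by rewrite -normE ger0_norm// ltW.
exists (rnorm M) => [|v]; first exact: rnorm_ge0.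
by have := TM v; rewrite {1}ME !normE -rmorphM lecR.
Qed.

Definition opnorm T : R := sup [set rnorm (T v) | v in [set v | rnorm v <= 1]].

Lemma le_opnorm T v : rnorm (T v) <= opnorm T * rnorm v.
Proof.
have [M M0 TM] := boundedOp_bounded T.
have [->|v0] := eqVneq v 0; first by rewrite linear0 !rnorm0 mulr0.
have rv0 : 0 < rnorm v.
  by rewrite lt_def rnorm_ge0 andbT; apply: contra_neq v0; exact: rnorm0_eq0.
have rV : rnorm (rnorm v)^-1%:C = (rnorm v)^-1.
  by rewrite /rnorm ger0_norm ?ler0c ?invr_ge0 ?rnorm_ge0.
rewrite -ler_pdivrMr// mulrC -rV -rnormZ -linearZ; apply: ub_le_sup.
  exists M => _ [w /= w1 <-]; apply: le_trans (TM w) _.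
  by rewrite ler_piMr.
by exists ((rnorm v)^-1%:C *: v); rewrite //= rnormZ rV mulVf ?gt_eqF.
Qed.

Lemma opnorm_le T (M : R) :
  0 <= M -> (forall v, rnorm (T v) <= M * rnorm v) -> opnorm T <= M.
Proof.
move=> M0 TM; apply: ge_sup.
  by exists (rnorm (T 0)); exists 0 => //=; rewrite rnorm0 ler01.
by move=> _ [w /= w1 <-]; apply: le_trans (TM w) _; rewrite ler_piMr.
Qed.

Lemma opnorm_ge0 T : 0 <= opnorm T.
Proof.
have [M M0 TM] := boundedOp_bounded T.
apply: (le_trans (rnorm_ge0 (T 0))); apply: ub_le_sup.
  exists M => _ [w /= w1 <-]; apply: le_trans (TM w) _.
  by rewrite ler_piMr.
by exists 0 => //=; rewrite rnorm0 ler01.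
Qed.

Let norm T : R[i] := (opnorm T)%:C.

Let normD S T : norm (S + T) <= norm S + norm T.
Proof.
rewrite /norm -rmorphD lecR; apply: opnorm_le => [|v].
  by rewrite addr_ge0 ?opnorm_ge0.
by apply: le_trans (rnormD _ _) _; rewrite mulrDl lerD ?le_opnorm.
Qed.

Let normZ (a : R[i]) T : norm (a *: T) = `|a| * norm T.
Proof.
have le b S : opnorm (b *: S) <= rnorm b * opnorm S.
  apply: opnorm_le => [|v]; first by rewrite mulr_ge0 ?rnorm_ge0 ?opnorm_ge0.
  by rewrite [_ v]/= rnormZ -mulrA ler_wpM2l ?rnorm_ge0 ?le_opnorm.
rewrite /norm normE -rmorphM; congr (_%:C); apply/eqP; rewrite eq_le le /=.
have [->|a0] := eqVneq a 0; first by rewrite rnorm0 mul0r opnorm_ge0.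
have ra0 : 0 < rnorm a.
  by rewrite lt_def rnorm_ge0 andbT; apply: contra_neq a0; exact: rnorm0_eq0.
rewrite -ler_pdivlMl//.
have -> : (rnorm a)^-1 = rnorm a^-1.
  apply: (mulfI (lt0r_neq0 ra0)); rewrite -rnormM !divff ?(lt0r_neq0 ra0)//.
  by rewrite /rnorm normr1.
by have := le a^-1 (a *: T); rewrite scalerA mulVf// scale1r.
Qed.

Let norm_eq0 T : norm T = 0 -> T = 0.
Proof.
move=> /complexI T0; apply/val_inj/funext => v; apply/rnorm0_eq0/eqP.
by rewrite eq_le rnorm_ge0 andbT; have := le_opnorm T v; rewrite T0 mul0r.
Qed.

HB.instance Definition _ :=
  Lmodule_isNormed.Build R[i] boundedOp normD normZ norm_eq0.

End boundedOp.

Section composition.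
Context (R : realType) (U V W : normedModType R[i]).

Lemma comp_continuous_linear (S : boundedOp V W) (T : boundedOp U V) :
  S \o T \in @continuous_linear R U W.
Proof.
apply/asboolP; split=> [a u v|u].
  by rewrite /= !linearP.
by apply: continuous_comp; exact: boundedOp_continuous.
Qed.

Definition op_comp (S : boundedOp V W) (T : boundedOp U V) : boundedOp U W :=
  BoundedOp (comp_continuous_linear S T).

End composition.

Section identity.
Context (R : realType) (V : normedModType R[i]).

Lemma id_continuous_linear : id \in @continuous_linear R V V.
Proof. by apply/asboolP; split=> // v; exact: cvg_id. Qed.

Definition op_id : boundedOp V V := BoundedOp id_continuous_linear.

End identity.

Section operators.
Context (R : realType) (X Y : choiceType).

Definition coef (T : boundedOp (ell2 R X) (ell2 R Y)) (x : X) (y : Y) : R[i] :=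
  ell2_dot (T (ell2_delta R x)) (ell2_delta R y).

Definition is_adjoint (T : boundedOp (ell2 R X) (ell2 R Y))
    (S : boundedOp (ell2 R Y) (ell2 R X)) : Prop :=
  forall u v, ell2_dot (T u) v = ell2_dot u (S v).

(* U is a unitary operator and V is its inverse U^* *)
Definition is_unitary (U : boundedOp (ell2 R X) (ell2 R Y))
    (V : boundedOp (ell2 R Y) (ell2 R X)) : Prop :=
  [/\ is_adjoint U V, op_comp V U = op_id _ & op_comp U V = op_id _].

Definition compact_op (T : boundedOp (ell2 R X) (ell2 R Y)) : Prop :=
  precompact (T @` [set v | `|v| <= 1]).

End operators.

Notation endOp R X := (boundedOp (ell2 R X) (ell2 R X)).

Definition is_projection (R : realType) (X : choiceType) (P : endOp R X) : Prop :=
  is_adjoint P P /\ op_comp P P = P.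

Definition supp (R : realType) (X : choiceType) (T : endOp R X) : set (X * X) :=
  [set xy | coef T xy.1 xy.2 <> 0].

Definition ell_infty (R : realType) (X : choiceType) : set (endOp R X) :=
  [set T | supp T `<=` diagonal].

Record coarseStructure (X : Type) := CoarseStructure {
  coarse_entourage :> set (X * X) -> Prop;
  coarse_diagonal : coarse_entourage diagonal;
  coarse_subset : forall A B, A `<=` B -> coarse_entourage B -> coarse_entourage A;
  coarse_inverse : forall A, coarse_entourage A -> coarse_entourage (A^-1)%relation;
  coarse_union : forall A B,
    coarse_entourage A -> coarse_entourage B -> coarse_entourage (A `|` B);
  (* the library writes B \; A for {(x, y) | exists z, A (x, z) /\ B (z, y)} *)
  coarse_composition : forall A B,
    coarse_entourage A -> coarse_entourage B -> coarse_entourage (B \; A)%relation }.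

Definition uniformly_locally_finite (X : Type) (E : coarseStructure X) : Prop :=
  forall A, E A -> exists N : nat, forall x, ([set y | A (x, y)] #<= `I_N)%card.

(* closure with respect to the operator norm *)
Definition uniform_roe (R : realType) (X : choiceType) (E : coarseStructure X) :
    set (endOp R X) :=
  closure [set T : endOp R X | E (supp T)].

Definition is_ghost (R : realType) (X : choiceType) (E : coarseStructure X)
    (T : endOp R X) : Prop :=
  uniform_roe E T /\
  forall e : R, 0 < e -> exists2 A : set X, finite_set A &
    forall x x', ~ A x -> ~ A x' -> rnorm (coef T x x') < e.

Section isomorphisms.
Context (R : realType) (X Y : choiceType).

(* Only the restriction of Phi to the subalgebra A is relevant. *)
Record star_isomorphism (A : set (endOp R X)) (B : set (endOp R Y))
    (Phi : endOp R X -> endOp R Y) : Prop := StarIsomorphism {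
  star_iso_bij : set_bij A B Phi;
  star_iso_linear : forall (a : R[i]) S T, A S -> A T ->
    Phi (a *: S + T) = a *: Phi S + Phi T;
  star_iso_comp : forall S T, A S -> A T ->
    Phi (op_comp S T) = op_comp (Phi S) (Phi T);
  star_iso_adjoint : forall S T, A S -> A T ->
    is_adjoint S T -> is_adjoint (Phi S) (Phi T) }.

Definition rigidly_implemented (E : coarseStructure X)
    (Phi : endOp R X -> endOp R Y) : Prop :=
  exists U V, [/\ is_unitary U V,
    forall T, uniform_roe E T -> Phi T = op_comp (op_comp U T) V,
    (0 < ereal_inf [set ereal_sup [set (rnorm (coef U x y))%:E | y in [set: Y]]
                   | x in [set: X]])%E &
    (0 < ereal_inf [set ereal_sup [set (rnorm (coef V y x))%:E | x in [set: X]]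
                   | y in [set: Y]])%E].

End isomorphisms.

(* Main.v *)
Require Import Defs.
From HB Require Import structures.
From mathcomp Require Import all_boot all_order all_algebra finmap.
From mathcomp Require Import all_classical all_reals all_analysis.
From mathcomp Require summability.
From mathcomp Require Import ring lra.
Import Order.TTheory GRing.Theory Num.Theory numFieldNormedType.Exports.

(* An isomorphism Phi is always of the form T |-> U T U^* for a unitary U:
   transport a unit vector of the range of Phi(e_rr) along Phi(e_xr), where r
   represents the coarse component of x, to get an orthonormal family xi_x =
   U delta_x with U^* Phi(T) U = T.  Surjectivity of U holds because
   S = Phi^-1(e_yy) = U^* e_yy U is a nonzero idempotent with
   S^2 = ||U^* delta_y||^2 S.  If inf_x sup_y |<U delta_x, delta_y>| = 0, there
   are distinct x_n with |<U delta_{x_n}, delta_y>|^2 <= 2^-(n+1) for all y, and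
   then U P U^* is a ghost for the projection P onto the span of the
   delta_{x_n}.  The other infimum is handled by exchanging U and U^*. *)

Set Implicit Arguments.
Unset Strict Implicit.
Unset Printing Implicit Defensive.

Local Open Scope classical_set_scope.
Local Open Scope complex_scope.
Local Open Scope ring_scope.

#[local] Existing Instance summability.totally_filter.

(** * The inner product of [ell2] as an unconditional sum *)

Section inner_product.
Context (R : realType) (X : choiceType).
Implicit Types (u v w : ell2 R X) (x : X) (a : R[i]).

Lemma finsqsum_le u (A : {fset X}) :
  \sum_(x <- A) rnorm (u x) ^+ 2 <= ell2_norm u ^+ 2.
Proof.
rewrite -lee_fin ell2_normK; apply: esum_ge; exists [set` A].
  by split => //; exact: finite_fset.
by rewrite fsbig_finite ?finite_fset// set_fsetK sumEFin.
Qed.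

Lemma partial_sumE (f : X -> R[i]) (A : {fset X}) :
  summability.partial_sum (f : X -> R[i]^o) A = \sum_(x <- A) f x.
Proof. by rewrite big_seq_fsetE. Qed.

(** The partial sums increase with the finite set and have supremum [sqsum u], so a finite set that
    comes within [e] of it serves for all larger ones. *)
Lemma ell2_norm_cvg u :
  summability.partial_sum (fun x => `|u x| ^+ 2 : R[i]^o) @ summability.totally
    --> (`|u| ^+ 2 : R[i]^o).
Proof.
apply/cvgrPdist_lt => e; rewrite ltcE /= => /andP[/eqP im0 e0].
have [A hA] : exists A : {fset X},
    ell2_norm u ^+ 2 - complex.Re e < \sum_(x <- A) rnorm (u x) ^+ 2.
  have : ((ell2_norm u ^+ 2 - complex.Re e)%:E < sqsum u)%E.
    by rewrite -ell2_normK lte_fin ltrBlDr ltrDl.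
  case/ereal_sup_gt => _ [A [fA _] <-]; rewrite fsbig_finite//= sumEFin lte_fin.
  by move=> hA; exists (fset_set A).
exists A => //= B AB.
have -> : summability.partial_sum (fun x => `|u x| ^+ 2 : R[i]^o) B =
    (\sum_(x <- B) rnorm (u x) ^+ 2)%:C.
  rewrite partial_sumE rmorph_sum /=.
  by apply: eq_bigr => x _; rewrite normE rmorphXn.
have -> : `|u| ^+ 2 = (ell2_norm u ^+ 2)%:C by rewrite rmorphXn.
have eE : e = (complex.Re e)%:C by move: im0; case: (e) => a b /= ->.
rewrite eE -rmorphB /= ger0_norm ?ler0c ?subr_ge0 ?finsqsum_le// ltcR.
rewrite ltrBlDr -ltrBlDl; apply: lt_le_trans hA _.
rewrite (eq_big_seq (fun x => if x \in A then rnorm (u x) ^+ 2 else 0)); last first.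
  by move=> x /= ->.
rewrite (big_fset_incl _ AB) => [|x _ /negPf-> //].
by apply: ler_sum => x _; case: ifP; rewrite ?sqr_ge0.
Qed.

Lemma ell2_dot_cvg u v :
  summability.partial_sum (fun x => u x * (v x)^* : R[i]^o) @ summability.totally
    --> (ell2_dot u v : R[i]^o).
Proof.
apply/cvg_ex; exists (4^-1 * (`|u + v| ^+ 2 - `|u - v| ^+ 2 +
    'i * (`|u + 'i *: v| ^+ 2 - `|u - 'i *: v| ^+ 2)) : R[i]^o).
(* Polarization: the norm sums converge by monotonicity. *)
have pol (a b : R[i]) : a * b^* = 4^-1 * (`|a + b| ^+ 2 - `|a - b| ^+ 2 +
    'i * (`|a + 'i * b| ^+ 2 - `|a - 'i * b| ^+ 2)).
  rewrite !normCK !(rmorphD, rmorphB, rmorphM, rmorphN) /= conjCi.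
  have := sqrCi R[i]; set i := 'i => i2.
  by field: i2.
have -> : summability.partial_sum (fun x => u x * (v x)^* : R[i]^o) =
    (fun A => 4^-1 * (summability.partial_sum (fun x => `|(u + v) x| ^+ 2 : R[i]^o) A -
      summability.partial_sum (fun x => `|(u - v) x| ^+ 2 : R[i]^o) A +
      'i * (summability.partial_sum (fun x => `|(u + 'i *: v) x| ^+ 2 : R[i]^o) A -
        summability.partial_sum (fun x => `|(u - 'i *: v) x| ^+ 2 : R[i]^o) A)) : R[i]^o).
  apply/funext => A; rewrite !partial_sumE -!sumrB mulr_sumr -big_split /=.
  by rewrite mulr_sumr; apply: eq_bigr => x _; rewrite pol.
apply: cvgMr; apply: cvgD.
  by apply: cvgB; exact: ell2_norm_cvg.
apply: cvgMr.
by apply: cvgB; exact: ell2_norm_cvg.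
Qed.

(** The basic rules for [ell2_dot] below are all obtained by exhibiting a limit of the partial sums
    and appealing to this uniqueness. *)
Lemma ell2_dot_unique u v a :
  summability.partial_sum (fun x => u x * (v x)^* : R[i]^o) @ summability.totally
    --> (a : R[i]^o) -> ell2_dot u v = a.
Proof.
move=> h.
exact: (cvg_unique (@norm_hausdorff _ R[i]^o) (@ell2_dot_cvg u v) h).
Qed.

Lemma ell2_dotuu u : ell2_dot u u = `|u| ^+ 2.
Proof.
apply: (@ell2_dot_unique _ _ _); under eq_fun do rewrite -normCK.
exact: ell2_norm_cvg.
Qed.

Lemma ell2_dotDl u v w : ell2_dot (u + v) w = ell2_dot u w + ell2_dot v w.
Proof.
apply: (@ell2_dot_unique _ _ _).
rewrite [X in X @ _](_ : _ =
  summability.partial_sum (fun x => u x * (w x)^* : R[i]^o) +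
  summability.partial_sum (fun x => v x * (w x)^* : R[i]^o)); last first.
  apply/funext => A; rewrite /= [RHS]/GRing.add/= !partial_sumE -big_split /=.
  by apply: eq_bigr => x _; rewrite mulrDl.
by apply: cvgD; exact: ell2_dot_cvg.
Qed.

Lemma ell2_dotZl a u v : ell2_dot (a *: u) v = a * ell2_dot u v.
Proof.
apply: (@ell2_dot_unique _ _ _).
rewrite [X in X @ _](_ : _ = fun A => a *
  summability.partial_sum (fun x => u x * (v x)^* : R[i]^o) A); last first.
  apply/funext => A; rewrite !partial_sumE mulr_sumr /=.
  by apply: eq_bigr => x _; rewrite mulrA.
by apply: cvgMr; exact: ell2_dot_cvg.
Qed.

Lemma ell2_dotC u v : ell2_dot v u = (ell2_dot u v)^*.
Proof.
apply: (@ell2_dot_unique _ _ _); apply/cvgrPdist_lt => e e0.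
have /cvgrPdist_lt/(_ e e0) := @ell2_dot_cvg u v.
apply: filterS => A; rewrite !partial_sumE -(norm_conjC (_ - _)).
rewrite rmorphB /= rmorph_sum /=; congr (`|_ - _| < _).
by apply: eq_bigr => x _; rewrite rmorphM /= conjCK mulrC.
Qed.

Lemma ell2_dotNl u v : ell2_dot (- u) v = - ell2_dot u v.
Proof. by rewrite -scaleN1r ell2_dotZl mulN1r. Qed.

Lemma ell2_dotBl u v w : ell2_dot (u - v) w = ell2_dot u w - ell2_dot v w.
Proof. by rewrite ell2_dotDl ell2_dotNl. Qed.

Lemma ell2_dotDr u v w : ell2_dot w (u + v) = ell2_dot w u + ell2_dot w v.
Proof. by rewrite ell2_dotC ell2_dotDl rmorphD /= -!ell2_dotC. Qed.

Lemma ell2_dotZr a u v : ell2_dot v (a *: u) = a^* * ell2_dot v u.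
Proof. by rewrite ell2_dotC ell2_dotZl rmorphM /= -!ell2_dotC. Qed.

Lemma ell2_dotBr u v w : ell2_dot w (u - v) = ell2_dot w u - ell2_dot w v.
Proof. by rewrite ell2_dotC ell2_dotBl rmorphB /= -!ell2_dotC. Qed.

Lemma ell2_dot0l u : ell2_dot 0 u = 0.
Proof. by rewrite -(scale0r 0) ell2_dotZl mul0r. Qed.

Lemma ell2_dot0r u : ell2_dot u 0 = 0.
Proof. by rewrite ell2_dotC ell2_dot0l rmorph0. Qed.

Lemma ell2_dot_delta u x : ell2_dot u (ell2_delta R x) = u x.
Proof.
apply: (@ell2_dot_unique _ _ _); apply/cvgrPdist_lt => e e0.
exists [fset x]%fset => // B; rewrite /= fsub1set => xB.
rewrite partial_sumE (big_fsetD1 x)//= /dirac_fun eqxx rmorph1 mulr1 big1_fset ?addr0.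
  by rewrite subrr normr0.
by move=> y; rewrite !inE /dirac_fun => /andP[/negPf-> _] _; rewrite rmorph0 mulr0.
Qed.

Lemma ell2_deltaE x y : ell2_delta R x y = (y == x)%:R.
Proof. by []. Qed.

Lemma norm_delta x : `|ell2_delta R x| = 1.
Proof.
have := ell2_dotuu (ell2_delta R x); rewrite ell2_dot_delta ell2_deltaE eqxx.
by move=> /esym/eqP; rewrite sqrp_eq1 => // /eqP.
Qed.

(** Expand the squared norm of [||v||^2 u - <u, v> v], which is [||v||^2] times the part of [u]
    orthogonal to [v]; a factor [||v||^2] splits off. *)
Lemma ell2_CS u v : `|ell2_dot u v| <= `|u| * `|v|.
Proof.
have [->|v0] := eqVneq v 0; first by rewrite ell2_dot0r !normr0 mulr0.
have v1 : 0 < `|v| by rewrite normr_gt0.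
rewrite -(@ler_pXn2r _ 2) ?nnegrE ?mulr_ge0//.
have := exprn_ge0 2 (normr_ge0 (`|v| ^+ 2 *: u - ell2_dot u v *: v)).
rewrite -(ell2_dotuu (_ - _)) ell2_dotBl !ell2_dotBr !ell2_dotZl !ell2_dotZr.
rewrite !ell2_dotuu (ell2_dotC u v) rmorphXn /= (geC0_conj (normr_ge0 v)).
set b := `|v| ^+ 2; set d := ell2_dot u v.
have -> : b * (b * `|u| ^+ 2) - b * (d^* * d) - (d * (b * d^*) - d * (d^* * b)) =
    b * (`|u| ^+ 2 * b - d * d^*) by ring.
by rewrite pmulr_rge0 ?exprn_gt0// subr_ge0 exprMn normCK.
Qed.

End inner_product.

(** * Orthonormal expansions, bounded operators and adjoints *)

Lemma bounded_continuous_linear (R : realType) (V W : normedModType R[i])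
    (f : V -> W) (M : R) :
  linear f -> (forall v, rnorm (f v) <= M * rnorm v) ->
  f \in @continuous_linear R V W.
Proof.
move=> linf fM.
pose g : {linear V -> W} := HB.pack f (GRing.isLinear.Build _ _ _ _ f linf).
apply/asboolP; split => //; apply/(linear_bounded_continuous g)/linear_boundedP.
near=> r => v.
apply: (@le_trans _ _ (M%:C * `|v|)); first by rewrite !normE -rmorphM lecR fM.
apply: ler_wpM2r => //; near: r; apply: nbhs_pinfty_ge.
by rewrite complex_real.
Unshelve. all: by end_near.
Qed.

Section operators.
Context (R : realType).

Lemma ell2_dot_suml (X : choiceType) I (r : seq I) (f : I -> ell2 R X) v :
  ell2_dot (\sum_(i <- r) f i) v = \sum_(i <- r) ell2_dot (f i) v.
Proof.
by elim/big_rec2 : _ => [|i a w _ <-]; rewrite ?ell2_dot0l// ell2_dotDl.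
Qed.

Lemma ell2_dot_sumr (X : choiceType) I (r : seq I) (f : I -> ell2 R X) v :
  ell2_dot v (\sum_(i <- r) f i) = \sum_(i <- r) ell2_dot v (f i).
Proof.
by elim/big_rec2 : _ => [|i a w _ <-]; rewrite ?ell2_dot0r// ell2_dotDr.
Qed.

Lemma orthonormal_sum (X I : choiceType) (xi : I -> ell2 R X)
    (A : {fset I}) (c : I -> R[i]) :
  (forall i j, ell2_dot (xi i) (xi j) = (i == j)%:R) ->
  `|\sum_(i <- A) c i *: xi i| ^+ 2 = \sum_(i <- A) `|c i| ^+ 2.
Proof.
move=> on; rewrite -ell2_dotuu ell2_dot_suml big_seq [RHS]big_seq.
apply: eq_bigr => i iA.
rewrite ell2_dot_sumr (big_fsetD1 i)//= ell2_dotZl ell2_dotZr on eqxx mulr1 -normCK.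
rewrite big1_fset ?addr0// => j; rewrite !inE => /andP[ji _] _.
by rewrite ell2_dotZl ell2_dotZr on eq_sym (negPf ji) !mulr0.
Qed.

Lemma delta_orthonormal (X : choiceType) (x y : X) :
  ell2_dot (ell2_delta R x) (ell2_delta R y) = (x == y)%:R.
Proof. by rewrite ell2_dot_delta ell2_deltaE eq_sym. Qed.

(** For the partial sum [t], both [<t, t>] and [<u, t>] equal [b], so [||u - t||^2 = ||u||^2 - b],
    which tends to 0 by [ell2_norm_cvg]. *)
Lemma ell2_sum_cvg (X : choiceType) (u : ell2 R X) :
  (fun A : {fset X} => \sum_(x <- A) u x *: ell2_delta R x) @ summability.totally --> u.
Proof.
apply/cvgrPdist_lt => e e0.
have e20 : 0 < e ^+ 2 by rewrite exprn_gt0.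
have /cvgrPdist_lt/(_ _ e20) := @ell2_norm_cvg R X u.
apply: filterS => A; rewrite partial_sumE; set b := \sum_(x <- A) _ => h.
rewrite -(@ltr_pXn2r _ 2) ?nnegrE ?(ltW e0)//; apply: le_lt_trans h.
rewrite -(ell2_dotuu (u - _)); set t := \sum_(x <- A) _.
have tt : ell2_dot t t = b.
  by rewrite ell2_dotuu orthonormal_sum//; exact: delta_orthonormal.
have ut : ell2_dot u t = b.
  rewrite ell2_dot_sumr; apply: eq_bigr => x _.
  by rewrite ell2_dotZr ell2_dot_delta normCK mulrC.
rewrite ell2_dotBl !ell2_dotBr (ell2_dotC u t) ell2_dotuu ut tt.
have b0 : 0 <= b by rewrite sumr_ge0// => x _; rewrite exprn_ge0.
rewrite (geC0_conj b0) subrr subr0 real_ler_norm//.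
by rewrite rpredB// ger0_real// exprn_ge0.
Qed.

(** Finite combinations of the [delta_x] are dense and both operators are continuous. *)
Lemma op_ext (X : choiceType) (W : normedModType R[i]) (S T : boundedOp (ell2 R X) W) :
  (forall x, S (ell2_delta R x) = T (ell2_delta R x)) -> S = T.
Proof.
move=> ST; apply/val_inj/funext => u /=.
have lim (Q : boundedOp (ell2 R X) W) :
  (fun A : {fset X} => Q (\sum_(x <- A) u x *: ell2_delta R x)) @ summability.totally --> Q u.
  by apply: (cvg_comp _ _ (@ell2_sum_cvg X u)); exact: boundedOp_continuous.
apply: (cvg_unique (@norm_hausdorff _ W) (lim S)).
rewrite [X in X @ _](_ : _ =
  (fun A : {fset X} => T (\sum_(x <- A) u x *: ell2_delta R x))); first exact: lim.
apply/funext => A; rewrite !linear_sum; apply: eq_bigr => x _.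
by rewrite !linearZ /= ST.
Qed.

Lemma ell2_dot_cvgl (X : choiceType) (T : Type) (F : set_system T) {FF : Filter F}
    (f : T -> ell2 R X) (u v : ell2 R X) :
  f @ F --> u -> (fun t => ell2_dot (f t) v : R[i]^o) @ F --> (ell2_dot u v : R[i]^o).
Proof.
move=> /cvgrPdist_lt fu; apply/cvgrPdist_lt => e e0.
have e1 : 0 < e / (`|v| + 1) by rewrite divr_gt0// ltr_wpDl.
apply: filterS (fu _ e1) => t ht; rewrite -ell2_dotBl.
apply: le_lt_trans (ell2_CS _ _) _.
apply: (@le_lt_trans _ _ (`|u - f t| * (`|v| + 1))).
  by rewrite ler_wpM2l// lerDl.
by rewrite -ltr_pdivlMr// ltr_wpDl.
Qed.

(** By duality, a bound [M] on the synthesis map [c |-> sum c_x xi_x] bounds the analysis map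
    [v |-> (<v, xi_x>)_x]. This one construction supplies adjoints as well as the unitary that
    implements [Phi]. *)
Lemma bessel_op (X Y : choiceType) (xi : X -> ell2 R Y) (M : R) : 0 <= M ->
  (forall (A : {fset X}) (c : X -> R[i]),
    rnorm (\sum_(x <- A) c x *: xi x) ^+ 2 <= M ^+ 2 * \sum_(x <- A) rnorm (c x) ^+ 2) ->
  exists V : boundedOp (ell2 R Y) (ell2 R X), forall v x, V v x = ell2_dot v (xi x).
Proof.
move=> M0 xiM.
have fin v (A : {fset X}) :
    \sum_(x <- A) rnorm (ell2_dot v (xi x)) ^+ 2 <= (M * rnorm v) ^+ 2.
  (* Testing the hypothesis on the coefficients of [v] itself gives [<v, t> = b]. Then
     [b^2 <= ||v||^2 ||t||^2 <= ||v||^2 M^2 b] by Cauchy-Schwarz, and one factor [b] cancels. *)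
  set c := fun x => ell2_dot v (xi x); set b := \sum_(x <- A) _.
  have b0 : 0 <= b by rewrite sumr_ge0// => x _; rewrite sqr_ge0.
  have := xiM A c; rewrite -/b; set t := \sum_(x <- A) _ => tb.
  have vt : ell2_dot v t = b%:C.
    rewrite /t /b rmorph_sum /=.
    elim/big_ind2 : _ => [|a w a' d <- <-|x _]; rewrite ?ell2_dot0r//.
      by rewrite ell2_dotDr.
    by rewrite ell2_dotZr rmorphXn /= -normE normCK mulrC.
  have : b <= rnorm v * rnorm t.
    by have := ell2_CS v t; rewrite vt ger0_norm ?ler0c// !normE -rmorphM lecR.
  have [->|bn0] := eqVneq b 0; first by rewrite sqr_ge0.
  have bp : 0 < b by rewrite lt_def bn0.
  rewrite -(@ler_pXn2r _ 2) ?nnegrE ?mulr_ge0 ?rnorm_ge0// exprMn => bvt.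
  rewrite -(ler_pM2r bp) -expr2; apply: le_trans bvt _.
  by have := ler_wpM2l (sqr_ge0 (rnorm v)) tb; lra.
have esumle v : (sqsum (fun x => ell2_dot v (xi x)) <= ((M * rnorm v) ^+ 2)%:E)%E.
  apply: ge_ereal_sup => _ [A [fA _] <-].
  by rewrite fsbig_finite//= sumEFin lee_fin fin.
have mem v : (fun x => ell2_dot v (xi x)) \in @sqsummable R X.
  by rewrite inE; apply: le_lt_trans (esumle v) _; rewrite ltry.
suff Vc : (fun v => Ell2 (mem v)) \in @continuous_linear R (ell2 R Y) (ell2 R X).
  by exists (BoundedOp Vc).
apply: (@bounded_continuous_linear _ _ _ _ M).
- move=> a u v; apply/val_inj/funext => x /=.
  by rewrite ell2_dotDl ell2_dotZl.
- move=> v; rewrite -(@ler_pXn2r _ 2) ?nnegrE ?mulr_ge0 ?rnorm_ge0//.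
  by rewrite -lee_fin; apply: le_trans (esumle v); rewrite -(ell2_normK (Ell2 (mem v))).
Qed.

Lemma rnorm_orthonormal_sum (X I : choiceType) (xi : I -> ell2 R X)
    (A : {fset I}) (c : I -> R[i]) :
  (forall i j, ell2_dot (xi i) (xi j) = (i == j)%:R) ->
  rnorm (\sum_(i <- A) c i *: xi i) ^+ 2 = \sum_(i <- A) rnorm (c i) ^+ 2.
Proof.
move=> on; apply/complexI; rewrite rmorphXn /= -normE orthonormal_sum// rmorph_sum.
by apply: eq_bigr => i _; rewrite rmorphXn /= -normE.
Qed.

(** The adjoint is the analysis map of the family [T delta_x]. The identity is clear for finite
    partial sums of [u] and passes to the limit by continuity of [T] and of the inner product. *)
Lemma adjoint_exists (X Y : choiceType) (T : boundedOp (ell2 R X) (ell2 R Y)) :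
  exists S, is_adjoint T S.
Proof.
have [||S SE] := @bessel_op X Y (fun x => T (ell2_delta R x)) (opnorm T).
- exact: opnorm_ge0.
- move=> A c; rewrite -(rnorm_orthonormal_sum _ _ (@delta_orthonormal X)) -exprMn.
  rewrite ler_pXn2r ?nnegrE ?mulr_ge0 ?opnorm_ge0 ?rnorm_ge0//.
  under eq_bigr do rewrite -linearZ.
  by rewrite -linear_sum le_opnorm.
exists S => u v; apply/esym/ell2_dot_unique.
rewrite [X in X @ _](_ : _ =
    fun A : {fset X} => ell2_dot (T (\sum_(x <- A) u x *: ell2_delta R x)) v : R[i]^o).
  apply: ell2_dot_cvgl; apply: (cvg_comp _ _ (@ell2_sum_cvg X u)).
  exact: boundedOp_continuous.
apply/funext => A; rewrite partial_sumE linear_sum.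
elim/big_ind2 : _ => [|a w a' d -> ->|x _]; rewrite ?ell2_dot0l//.
  by rewrite ell2_dotDl.
by rewrite SE -ell2_dotC linearZ ell2_dotZl.
Qed.

End operators.

Section operator_evaluation.
Context (R : realType) (U V W : normedModType R[i]).

Lemma op_compE (S : boundedOp V W) (T : boundedOp U V) u : op_comp S T u = S (T u).
Proof. by []. Qed.

Lemma op_scaleE (a : R[i]) (T : boundedOp U V) u : (a *: T) u = a *: T u.
Proof. by []. Qed.

End operator_evaluation.

(** * Matrix units and coordinate projections *)

Section matrix_units.
Context (R : realType) (X : choiceType).
Implicit Types (u v : ell2 R X) (x y z : X) (S T : endOp R X) (A : set X).

Lemma rnorm_coord u x : rnorm (u x) <= rnorm u.
Proof.
have : rnorm (u x) ^+ 2 <= rnorm u ^+ 2.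
  by have := finsqsum_le u [fset x]%fset; rewrite big_seq_fset1.
by rewrite ler_pXn2r ?nnegrE ?rnorm_ge0.
Qed.

Lemma rnorm_delta x : rnorm (ell2_delta R x) = 1.
Proof. by rewrite /rnorm norm_delta. Qed.

Lemma matrix_unit_subproof x z :
  (fun u => u z *: ell2_delta R x) \in @continuous_linear R (ell2 R X) (ell2 R X).
Proof.
apply: (@bounded_continuous_linear _ _ _ _ 1) => [a u v|v].
  by rewrite /= scalerDl scalerA.
by rewrite rnormZ rnorm_delta mulr1 mul1r rnorm_coord.
Qed.

Lemma ell2_scaleE (a : R[i]) u x : (a *: u) x = a * u x. Proof. by []. Qed.

(** This is [e_xz], sending [delta_z] to [delta_x]. Since [coef] and [supp] list the source first,
    its support is the pair in reverse order, [(z, x)]. *)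
Definition matrix_unit x z : endOp R X := BoundedOp (matrix_unit_subproof x z).

Lemma matrix_unitE x z u : matrix_unit x z u = u z *: ell2_delta R x.
Proof. by []. Qed.

Lemma coef_applyE (Y : choiceType) (T : boundedOp (ell2 R X) (ell2 R Y)) x (y : Y) :
  coef T x y = T (ell2_delta R x) y.
Proof. exact: ell2_dot_delta. Qed.

Lemma matrix_unit_delta x z y :
  matrix_unit x z (ell2_delta R y) = (y == z)%:R *: ell2_delta R x.
Proof. by rewrite matrix_unitE ell2_deltaE eq_sym. Qed.

Lemma matrix_unit_comp x y z : op_comp (matrix_unit x y) (matrix_unit y z) = matrix_unit x z.
Proof.
by apply: op_ext => w; rewrite op_compE !matrix_unitE ell2_scaleE !ell2_deltaE eqxx mulr1.
Qed.

Lemma matrix_unit_comp0 x y y' z : y != y' ->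
  op_comp (matrix_unit x y) (matrix_unit y' z) = 0.
Proof.
move=> /negPf yy; apply: op_ext => w.
by rewrite op_compE !matrix_unitE ell2_scaleE !ell2_deltaE yy mulr0 scale0r.
Qed.

Lemma matrix_unit_adj x y : is_adjoint (matrix_unit x y) (matrix_unit y x).
Proof.
move=> u v; rewrite !matrix_unitE ell2_dotZl ell2_dotZr ell2_dotC !ell2_dot_delta.
by rewrite mulrC.
Qed.

(** A matrix entry is thereby expressed through products and scalars alone, so that an algebra
    isomorphism carries it along. *)
Lemma matrix_unit_corner T x y :
  op_comp (matrix_unit y y) (op_comp T (matrix_unit x x)) = coef T x y *: matrix_unit y x.
Proof.
apply: op_ext => w; rewrite !op_compE op_scaleE !matrix_unit_delta coef_applyE.
case: (w == x); first by rewrite !scale1r matrix_unitE.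
by rewrite !scale0r linear0 scaler0 linear0.
Qed.

Lemma supp_matrix_unit x z : supp (matrix_unit x z) `<=` [set (z, x)].
Proof.
move=> [a b]; rewrite /supp /= coef_applyE matrix_unit_delta.
have [->|] := eqVneq a z; last by rewrite scale0r.
rewrite scale1r ell2_deltaE; have [->|] //= := eqVneq b x.
Qed.

Lemma restrict_subproof A u :
  (fun x => if `[< A x >] then u x else 0) \in @sqsummable R X.
Proof.
rewrite inE; apply: le_lt_trans (ell2P u); apply: le_esum => x _ /=.
by case: ifP; rewrite ?lexx// rnorm0 expr0n lee_fin sqr_ge0.
Qed.

Lemma restrict_op_subproof A :
  (fun u => Ell2 (restrict_subproof A u)) \in @continuous_linear R (ell2 R X) (ell2 R X).
Proof.
apply: (@bounded_continuous_linear _ _ _ _ 1) => [a u v|u].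
  apply/val_inj/funext => x /=.
  transitivity (a * (if `[< A x >] then u x else 0) + (if `[< A x >] then v x else 0)) => //.
  by case: ifP; rewrite ?addr0 ?mulr0.
rewrite mul1r -(@ler_pXn2r _ 2) ?nnegrE ?rnorm_ge0//.
rewrite -lee_fin (ell2_normK (Ell2 _)) (ell2_normK u); apply: le_esum => x _ /=.
by case: ifP; rewrite ?lexx// rnorm0 expr0n lee_fin sqr_ge0.
Qed.

(** The characteristic function of [A], viewed in [ell_infty]. *)
Definition restrict_op A : endOp R X := BoundedOp (restrict_op_subproof A).

Lemma restrict_opE A u x : restrict_op A u x = if `[< A x >] then u x else 0.
Proof. by []. Qed.

Lemma restrict_op_adj A : is_adjoint (restrict_op A) (restrict_op A).
Proof.
move=> u v; rewrite /ell2_dot.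
apply: (congr1 (@summability.sum X _ R[i]^o)); apply/funext => x.
by rewrite !restrict_opE; case: ifP; rewrite // mul0r rmorph0 mulr0.
Qed.

Lemma restrict_op_comp A : op_comp (restrict_op A) (restrict_op A) = restrict_op A.
Proof.
apply/val_inj/funext => u; apply/val_inj/funext => x /=.
by case: ifP => [->|].
Qed.

Lemma restrict_op_delta A x : A x -> restrict_op A (ell2_delta R x) = ell2_delta R x.
Proof.
move=> Ax; apply/val_inj/funext => y /=; rewrite /dirac_fun.
have [->|] := eqVneq y x; first by rewrite asboolT.
by case: ifP.
Qed.

Lemma restrict_op_ell_infty A : ell_infty (restrict_op A).
Proof.
move=> [a b]; rewrite /supp /diagonal /= coef_applyE restrict_opE ell2_deltaE.
by have [->//|] := eqVneq b a; case: ifP.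
Qed.

Lemma restrict_op_projection A : is_projection (restrict_op A).
Proof. by split; [exact: restrict_op_adj|exact: restrict_op_comp]. Qed.

End matrix_units.

Section adjoints.
Context (R : realType) (X Y : choiceType).
Implicit Types (T : boundedOp (ell2 R X) (ell2 R Y)).

Lemma coef_adjoint T S x y : is_adjoint T S -> coef S y x = (coef T x y)^*.
Proof. by move=> TS; rewrite /coef TS -ell2_dotC. Qed.

Lemma is_adjoint_sym T S : is_adjoint T S -> is_adjoint S T.
Proof. by move=> TS u v; rewrite ell2_dotC -TS -ell2_dotC. Qed.

Lemma rnorm_coef_le T x y : rnorm (coef T x y) <= opnorm T.
Proof.
rewrite coef_applyE; apply: le_trans (rnorm_coord _ _) _.
by apply: le_trans (le_opnorm _ _) _; rewrite rnorm_delta mulr1.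
Qed.

Lemma coef_ext S T : (forall x y, coef S x y = coef T x y) -> S = T.
Proof.
move=> ST; apply: op_ext => x; apply/val_inj/funext => y /=.
by rewrite -!coef_applyE.
Qed.

End adjoints.

Lemma opnorm_comp (R : realType) (U V W : normedModType R[i])
    (S : boundedOp V W) (T : boundedOp U V) :
  opnorm (op_comp S T) <= opnorm S * opnorm T.
Proof.
apply: opnorm_le => [|v]; first by rewrite mulr_ge0 ?opnorm_ge0.
apply: le_trans (le_opnorm S (T v)) _.
by rewrite -mulrA ler_wpM2l ?opnorm_ge0 ?le_opnorm.
Qed.

Lemma opnormD (R : realType) (V W : normedModType R[i]) (S T : boundedOp V W) :
  opnorm (S + T) <= opnorm S + opnorm T.
Proof. exact: (@rnormD R (boundedOp V W)). Qed.

Lemma opnormN (R : realType) (V W : normedModType R[i]) (T : boundedOp V W) :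
  opnorm (- T) = opnorm T.
Proof. exact: (congr1 (@complex.Re R) (normrN T)). Qed.

(** * The uniform Roe algebra and coarse components *)

Section roe.
Context (R : realType) (X : choiceType) (E : coarseStructure X).
Implicit Types (S T : endOp R X).

Lemma uniform_roeP T : uniform_roe E T <->
  forall e : R, 0 < e -> exists2 S, E (supp S) & opnorm (T - S) < e.
Proof.
split=> [cT e e0|h B].
  have eC0 : 0 < e%:C by rewrite ltcR.
  have [S [ES /= TS]] := cT _ (nbhsx_ballx T _ eC0).
  by exists S => //; rewrite -ltcR; move: TS; rewrite -ball_normE.
move=> /nbhs_ballP[e /= e0 eB].
(* Radii of balls are elements of [R[i]]; being positive, this one is real. *)
have eE : e = (complex.Re e)%:C.
  by move: e0; rewrite ltcE; case: (e) => a b /= /andP[/eqP-> _].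
have [|S ES TS] := h (complex.Re e); first by rewrite -ltcR -eE.
exists S; split => //; apply: eB; rewrite -ball_normE /= eE.
by rewrite [ltLHS]/(opnorm (T - S))%:C ltcR.
Qed.

Lemma uniform_roe_supp T : E (supp T) -> uniform_roe E T.
Proof. exact: subset_closure. Qed.

(** The entry at [(x, y)] is the sum over [z] of the entry of [T] at [(x, z)] times that of [S] at
    [(z, y)], read off through the adjoint of [S]. If no [z] links [x] to [y], every term
    vanishes. *)
Lemma supp_comp S T : supp (op_comp S T) `<=` (supp S \; supp T)%relation.
Proof.
move=> [x y]; rewrite /supp /= => /eqP STxy; apply: contrapT => h.
move/eqP: STxy; apply.
have [S' SS'] := adjoint_exists S.
rewrite /coef /= SS'; apply: ell2_dot_unique.
rewrite [X in X @ _](_ : _ = cst (0 : R[i]^o)); first exact: cvg_cst.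
apply/funext => A; rewrite partial_sumE big1// => z _.
have [/eqP|Tz] := eqVneq (coef T x z) 0; first by rewrite coef_applyE => /eqP->; rewrite mul0r.
have [Sz|Sz] := eqVneq (coef S z y) 0.
  by rewrite -[S' _ _]ell2_dot_delta -/(coef S' y z) (coef_adjoint _ _ SS') Sz rmorph0 rmorph0 mulr0.
by exfalso; apply: h; exists z => /=; apply/eqP.
Qed.

Lemma uniform_roe_comp S T :
  uniform_roe E S -> uniform_roe E T -> uniform_roe E (op_comp S T).
Proof.
move=> /uniform_roeP hS /uniform_roeP hT; apply/uniform_roeP => e e0.
pose k := opnorm S + opnorm T + 1.
have S0 := opnorm_ge0 S; have T0 := opnorm_ge0 T.
have k0 : 0 < k by rewrite /k; lra.
(* The error splits into two terms with total at most [d * (opnorm S + opnorm T + d)]; as [d <= 1],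
   this is at most [d * k <= e / 2]. *)
pose d := Num.min 1 (e / (2 * k)).
have d0 : 0 < d by rewrite lt_min ltr01 divr_gt0// mulr_gt0.
have [S' ES' SS'] := hS d d0; have [T' ET' TT'] := hT d d0.
exists (op_comp S' T').
  by apply: coarse_subset (@supp_comp _ _) _; exact: coarse_composition.
have -> : op_comp S T - op_comp S' T' = op_comp S (T - T') + op_comp (S - S') T'.
  apply/val_inj/funext => v.
  transitivity (S (T v - T' v) + (S (T' v) - S' (T' v))) => //.
  by rewrite [S (_ - _)]linearB [RHS]addrA [X in _ = X - _]subrK.
apply: (@le_lt_trans _ _ (opnorm S * d + d * (opnorm T + d))).
  apply: le_trans (opnormD _ _) _; apply: lerD.
    by apply: le_trans (opnorm_comp _ _) _; rewrite ler_wpM2l// ltW.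
  apply: le_trans (opnorm_comp _ _) _.
  rewrite ler_pM ?opnorm_ge0// ?(ltW SS')//.
  have -> : T' = T - (T - T') by rewrite opprB addrC subrK.
  by apply: le_trans (opnormD _ _) _; rewrite opnormN lerD2l ltW.
have d1 : d <= 1 by rewrite ge_min lexx.
have d2 : 2 * k * d <= e.
  by rewrite -ler_pdivlMl ?mulr_gt0// mulrC ge_min lexx orbT.
have : d * (opnorm S + opnorm T + d) <= d * k by rewrite ler_wpM2l ?(ltW d0)// lerD2l.
have : 0 < d * k by rewrite mulr_gt0.
lra.
Qed.

(** Entries are bounded by the operator norm, so an approximant closer to [T] than the modulus of
    this entry cannot vanish there. Hence nonzero entries occur only inside a coarse component. *)
Lemma uniform_roe_entourage T x y :
  uniform_roe E T -> coef T x y != 0 -> E [set (x, y)].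
Proof.
move=> /uniform_roeP hT Txy.
have e0 : 0 < rnorm (coef T x y).
  by rewrite lt_def rnorm_ge0 andbT; apply: contra_neq Txy; exact: rnorm0_eq0.
have [S ES TS] := hT _ e0; apply: coarse_subset ES => _ ->; rewrite /supp /= => Sxy.
have := le_lt_trans (rnorm_coef_le (T - S) x y) TS.
have -> : coef (T - S) x y = coef T x y - coef S x y by exact: ell2_dotBl.
by rewrite Sxy subr0 ltxx.
Qed.

Lemma uniform_roe_unit x z : E [set (z, x)] -> uniform_roe E (matrix_unit R x z).
Proof.
by move=> ?; apply: uniform_roe_supp; apply: coarse_subset (@supp_matrix_unit _ _ _ _) _.
Qed.

Lemma uniform_roe_restrict (A : set X) : uniform_roe E (restrict_op R A).
Proof.
apply: uniform_roe_supp; apply: coarse_subset (coarse_diagonal E).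
exact: restrict_op_ell_infty.
Qed.

Lemma coarse_refl x : E [set (x, x)].
Proof. by apply: coarse_subset (coarse_diagonal E) => _ ->. Qed.

Lemma coarse_sym x y : E [set (x, y)] -> E [set (y, x)].
Proof. by move=> /coarse_inverse; apply: coarse_subset => _ -> /=. Qed.

Lemma coarse_trans x y z : E [set (x, y)] -> E [set (y, z)] -> E [set (x, z)].
Proof.
move=> xy yz; apply: coarse_subset (coarse_composition xy yz) => _ ->.
by exists y.
Qed.

End roe.

(** [E [set (x, y)]] is an equivalence relation whose classes are the coarse components. [choose]
    depends on the class only: neither on how its predicate is presented nor on the member it starts
    from. *)
Lemma coarse_representatives (X : choiceType) (E : coarseStructure X) :
  exists rep : X -> X, (forall x, E [set (x, rep x)]) /\
    (forall x y, E [set (x, y)] -> rep x = rep y).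
Proof.
pose comp x : pred X := fun z => `[< E [set (x, z)] >].
have compx x : comp x x by apply/asboolP; exact: coarse_refl.
exists (fun x => choose (comp x) x); split=> [x|x y xy].
  by apply/asboolP; exact: (chooseP (compx x)).
have cxy : comp x =1 comp y.
  move=> z; apply/asboolP/asboolP => h; last exact: coarse_trans xy h.
  exact: coarse_trans (coarse_sym xy) h.
by rewrite (eq_choose cxy); apply: choose_id => //; rewrite -cxy; exact: compx.
Qed.

(** * Unitary implementation of an isomorphism *)

Section implementation.
Context (R : realType) (X Y : choiceType).
Context (E : coarseStructure X) (F : coarseStructure Y) (Phi : endOp R X -> endOp R Y).
Hypothesis iso : star_isomorphism (uniform_roe E) (uniform_roe F) Phi.

Local Notation e := (matrix_unit R).

Lemma star_iso_mem T : uniform_roe E T -> uniform_roe F (Phi T).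
Proof. by have [fn _ _] := star_iso_bij iso; exact: fn. Qed.

Lemma uniform_roe0 : uniform_roe E (0 : endOp R X).
Proof.
apply: uniform_roe_supp; apply: coarse_subset (coarse_diagonal E).
by move=> [x y]; rewrite /supp /= coef_applyE.
Qed.

Lemma star_iso0 : Phi 0 = 0.
Proof.
have := star_iso_linear iso 1 uniform_roe0 uniform_roe0.
by rewrite !scale1r addr0 => /esym/(canRL (addrK _)); rewrite subrr.
Qed.

Lemma star_isoZ a T : uniform_roe E T -> Phi (a *: T) = a *: Phi T.
Proof.
move=> ET; have := star_iso_linear iso a ET uniform_roe0.
by rewrite star_iso0 !addr0.
Qed.

Lemma star_iso_compE S T u : uniform_roe E S -> uniform_roe E T ->
  Phi S (Phi T u) = Phi (op_comp S T) u.
Proof. by move=> ES ET; rewrite (star_iso_comp iso ES ET). Qed.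

Lemma uniform_roe_diag x : uniform_roe E (e x x).
Proof. exact/uniform_roe_unit/coarse_refl. Qed.

(** [Phi (e x x)] is nonzero by injectivity and idempotent, so any nonzero value of it is fixed and
    can be normalized. *)
Lemma star_iso_range_unit_vector x :
  exists zeta, ell2_dot zeta zeta = 1 /\ Phi (e x x) zeta = zeta.
Proof.
have [_ inj _] := star_iso_bij iso.
have [v Qv] : exists v, Phi (e x x) v != 0.
  apply: contrapT => /forallNP h.
  have P0 : Phi (e x x) = Phi 0.
    rewrite star_iso0; apply/val_inj/funext => v /=.
    by apply/eqP/negPn/negP; exact: h.
  have := inj _ _ (mem_set (@uniform_roe_diag x)) (mem_set uniform_roe0) P0.
  move=> /(congr1 (fun T : endOp R X => coef T x x)) /=.
  rewrite !coef_applyE matrix_unit_delta eqxx scale1r ell2_deltaE eqxx => /eqP.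
  by rewrite oner_eq0.
set w := Phi (e x x) v in Qv.
have Qw : Phi (e x x) w = w.
  rewrite /w star_iso_compE ?matrix_unit_comp//; exact: uniform_roe_diag.
exists (`|w|^-1 *: w); split; last by rewrite linearZ /= Qw.
rewrite ell2_dotuu normrZ ger0_norm ?invr_ge0// mulVf ?expr1n//.
by rewrite normr_eq0.
Qed.

Lemma star_iso_frame : exists xi : X -> ell2 R Y,
  [/\ forall x y, ell2_dot (xi x) (xi y) = (x == y)%:R,
      forall x, Phi (e x x) (xi x) = xi x &
      forall x y, E [set (x, y)] -> Phi (e y x) (xi x) = xi y].
Proof.
have [rep [repE rep_eq]] := coarse_representatives E.
have [zeta zetaP] := choice star_iso_range_unit_vector.
pose xi x := Phi (e x (rep x)) (zeta (rep x)).
(* Points of one component share the representative [r], hence the vector [zeta r], and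
   [e_yx e_xr = e_yr]. *)
have move_xi x y : E [set (x, y)] -> Phi (e y x) (xi x) = xi y.
  move=> xy; rewrite /xi star_iso_compE ?matrix_unit_comp ?(rep_eq _ _ xy)//.
    exact: uniform_roe_unit.
  by apply/uniform_roe_unit; rewrite -(rep_eq _ _ xy); exact/coarse_sym.
have fix_xi x : Phi (e x x) (xi x) = xi x by apply/move_xi/coarse_refl.
exists xi; split => // x y.
(* On the diagonal, adjunction gives [<zeta, Phi(e_rr) zeta> = 1]. Off it, [e_yy e_xx = 0] makes the
   ranges orthogonal, whether or not the points share a component. *)
have [->|xy] := eqVneq x y.
  have Ery : E [set (rep y, y)] by exact/coarse_sym.
  have adj : is_adjoint (Phi (e y (rep y))) (Phi (e (rep y) y)).
    apply: (star_iso_adjoint iso); first exact: uniform_roe_unit.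
      exact: uniform_roe_unit.
    exact: matrix_unit_adj.
  rewrite {1}/xi adj /xi star_iso_compE ?matrix_unit_comp.
  - by have [? ->] := zetaP (rep y).
  - exact: uniform_roe_unit.
  - exact: uniform_roe_unit.
have adj : is_adjoint (Phi (e y y)) (Phi (e y y)).
  by apply: (star_iso_adjoint iso); first [exact: uniform_roe_diag|exact: matrix_unit_adj].
rewrite -(fix_xi x) -(fix_xi y) -adj star_iso_compE.
- by rewrite matrix_unit_comp0 ?star_iso0 ?ell2_dot0l// eq_sym.
- exact: uniform_roe_diag.
- exact: uniform_roe_diag.
Qed.

Lemma star_iso_unitary : exists U V, Defs.is_unitary U V /\
  forall T, uniform_roe E T -> Phi T = op_comp (op_comp U T) V.
Proof.
have [xi [xi_on xi_fix xi_move]] := star_iso_frame.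
have [//||V VE] := @bessel_op R X Y xi 1.
  by move=> A c; rewrite expr1n mul1r rnorm_orthonormal_sum.
(* The analysis map [V] of the frame is built first; [U] is its adjoint and sends [delta_x] to
   [xi x]. *)
have [U VU] := adjoint_exists V.
have UV := is_adjoint_sym VU.
have UE x : U (ell2_delta R x) = xi x.
  apply/val_inj/funext => y /=.
  by rewrite -ell2_dot_delta UV ell2_dotC ell2_dot_delta VE -ell2_dotC ell2_dot_delta.
have VxiE T x x' : V (T (U (ell2_delta R x))) x' = ell2_dot (T (xi x)) (xi x').
  by rewrite UE VE.
have VU1 : op_comp V U = op_id _.
  apply: coef_ext => x x'; rewrite !coef_applyE /= -!/(ell2_delta _ _).
  by rewrite UE VE xi_on /dirac_fun eq_sym.
(* Entries are compared after compressing by [e_xx] and [e_x'x']. A nonzero entry of [T] forces [x]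
   and [x'] into one component, where [Phi(e_x'x)] carries [xi x] to [xi x']. *)
have VPhiU T : uniform_roe E T -> op_comp V (op_comp (Phi T) U) = T.
  move=> ET; apply: coef_ext => x x'; rewrite coef_applyE !op_compE VxiE.
  have adj : is_adjoint (Phi (e x' x')) (Phi (e x' x')).
    by apply: (star_iso_adjoint iso); first [exact: uniform_roe_diag|exact: matrix_unit_adj].
  rewrite -(xi_fix x) -(xi_fix x') -adj -!op_compE.
  have ETe : uniform_roe E (op_comp T (e x x)).
    by apply: uniform_roe_comp => //; exact: uniform_roe_diag.
  have -> : op_comp (Phi (e x' x')) (op_comp (Phi T) (Phi (e x x))) =
            Phi (coef T x x' *: e x' x).
    rewrite -matrix_unit_corner (star_iso_comp iso) ?(star_iso_comp iso)//;
    exact: uniform_roe_diag.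
  have [->|Txx] := eqVneq (coef T x x') 0.
    by rewrite scale0r star_iso0 ell2_dot0l.
  have Exx := uniform_roe_entourage ET Txx.
  rewrite star_isoZ; last exact: uniform_roe_unit.
  by rewrite op_scaleE xi_move// ell2_dotZl xi_on eqxx mulr1.
have UV1 : op_comp U V = op_id _.
  apply: op_ext => y; rewrite op_compE /=.
  have [S ES PS] : exists2 S, uniform_roe E S & Phi S = matrix_unit R y y.
    have [_ _ sur] := star_iso_bij iso.
    have [|S ES PS] := sur (matrix_unit R y y); last by exists S.
    exact/uniform_roe_unit/coarse_refl.
  (* So [S = V e_yy U] has rank at most one: [S v] is the [y]-coordinate of [U v] times
     [V delta_y]. *)
  have SE := VPhiU _ ES; rewrite PS in SE.
  have SS : op_comp S S = S.
    have [_ inj _] := star_iso_bij iso.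
    apply: inj; rewrite ?inE//; first exact: uniform_roe_comp.
    by rewrite (star_iso_comp iso)// PS matrix_unit_comp.
  set p := ell2_dot (V (ell2_delta R y)) (V (ell2_delta R y)).
  have SvE v : S v = U v y *: V (ell2_delta R y).
    by rewrite -SE !op_compE matrix_unitE linearZ.
  have Vdp : U (V (ell2_delta R y)) y = p by rewrite -ell2_dot_delta UV.
  (* [S] is nonzero with [S^2 = S] and [S^2 = p S]. *)
  have p1 : p = 1.
    have [v Sv] : exists v, S v != 0.
      apply: contrapT => /forallNP h.
      have S0 : S = 0.
        by apply/val_inj/funext => v /=; apply/eqP/negPn/negP; exact: h.
      move: PS; rewrite S0 star_iso0 => /(congr1 (fun T : endOp R Y => coef T y y)) /=.
      rewrite !coef_applyE matrix_unit_delta eqxx scale1r ell2_deltaE eqxx => /esym/eqP.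
      by rewrite oner_eq0.
    have : S v = p *: S v.
      rewrite -{1}SS op_compE (SvE v) linearZ /= (SvE (V _)) Vdp.
      by rewrite !scalerA mulrC.
    move=> /eqP; rewrite -subr_eq0 -{1}(scale1r (S v)) -scalerBl scaler_eq0 (negPf Sv) orbF.
    by rewrite subr_eq0 => /eqP.
  have UVUV : ell2_dot (U (V (ell2_delta R y))) (U (V (ell2_delta R y))) = p.
    by rewrite UV -op_compE VU1.
  (* The squared norm of [U V delta_y - delta_y] is [p - p - p^* + 1], which is 0 for [p = 1]. *)
  apply/eqP; rewrite -subr_eq0 -normr_eq0 -sqrf_eq0 -ell2_dotuu.
  rewrite ell2_dotBl !ell2_dotBr UVUV UV (ell2_dotC (U _)) UV -/p p1 rmorph1 delta_orthonormal eqxx.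
  by rewrite !subrr.
exists U, V; split => // T ET.
have UVE w : U (V w) = w by rewrite -op_compE UV1.
have TE w : T w = V (Phi T (U w)) by rewrite -{1}(VPhiU T ET).
by apply/val_inj/funext => v /=; rewrite TE !UVE.
Qed.

End implementation.

(** * Columns with small entries and the ghost projection they span *)

Section small_columns.
Context (R : realType) (X Y : choiceType).
Implicit Types (U : boundedOp (ell2 R X) (ell2 R Y)) (V : boundedOp (ell2 R Y) (ell2 R X)).

Lemma small_columns U V : op_comp V U = op_id _ ->
  ~ (0 < ereal_inf [set ereal_sup [set (rnorm (coef U x y))%:E | y in [set: Y]]
                   | x in [set: X]])%E ->
  exists2 x : nat -> X, injective x &
    forall n y, rnorm (coef U (x n) y) ^+ 2 <= 1 / (2 ^ n.+1)%:R.
Proof.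
move=> VU /negP; rewrite -leNgt => inf0.
(* [g e] indexes a column all of whose entries are at most [e]; such columns exist because the
   infimum is not positive. *)
have /choice[g gP] (e : {posnum R}) : exists x, forall y, rnorm (coef U x y) <= e%:num.
  have e0 : (0 < e%:num%:E)%E by rewrite lte_fin.
  have /ereal_inf_lt[_ [x _ <-] xe] := le_lt_trans inf0 e0.
  exists x => y; rewrite -lee_fin; apply: le_trans (ltW xe).
  by apply: ereal_sup_ubound; exists y.
(* No column is zero, since [V] inverts [U] on the left; [h x] is half of a nonzero entry of column
   [x], hence strictly exceeded by that entry. *)
have /choice[h hP] x : exists h : {posnum R}, exists y, h%:num < rnorm (coef U x y).
  have [y Uy] : exists y, coef U x y != 0.
    apply: contrapT => /forallNP Ux0.
    have U0 : U (ell2_delta R x) = 0.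
      apply/val_inj/funext => y /=; rewrite -coef_applyE.
      by apply/eqP/negPn/negP; exact: Ux0.
    have := @rnorm_delta R X x.
    have <- : V (U (ell2_delta R x)) = ell2_delta R x by rewrite -op_compE VU.
    by rewrite U0 linear0 rnorm0 => /eqP; rewrite eq_sym oner_eq0.
  have r0 : 0 < rnorm (coef U x y).
    by rewrite lt_def rnorm_ge0 andbT; apply: contra_neq Uy; exact: rnorm0_eq0.
  have r2 : 0 < rnorm (coef U x y) / 2 by rewrite divr_gt0.
  by exists (PosNum r2), y => /=; lra.
(* Going below [h (g e)] makes every later column differ from the current one; halving gives the
   geometric decay. *)
have /choice[step stepP] (e : {posnum R}) : exists e' : {posnum R},
    e'%:num <= (h (g e))%:num /\ e'%:num <= e%:num / 2.
  have m0 : 0 < Num.min (h (g e))%:num (e%:num / 2) by rewrite lt_min !gt0.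
  by exists (PosNum m0); split; rewrite /= ge_min lexx ?orbT.
have half0 : 0 < 1 / 2 :> R by rewrite divr_gt0.
pose s n : {posnum R} := iter n step (PosNum half0).
have s2 n : (s n)%:num <= 1 / (2 ^ n.+1)%:R.
  elim: n => [|n IH] /=; first by rewrite expn1.
  apply: le_trans (stepP _).2 _; rewrite expnS natrM invfM mulrA mulrAC.
  by rewrite ler_pM2r ?invr_gt0.
have sS m : (s m.+1)%:num <= (s m)%:num.
  by apply: le_trans (stepP (s m)).2 _; rewrite ler_pdivrMr// ler_peMr// ler1n.
have sle m n : (m <= n)%N -> (s n)%:num <= (s m)%:num.
  move=> /subnK <-; elim: (n - m)%N => [//|k IH]; rewrite addSn.
  exact: le_trans (sS _) IH.
exists (g \o s) => [|n y /=].
  have lt m n : (m < n)%N -> g (s m) <> g (s n).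
    move=> mn gmn; have [y] := hP (g (s m)); rewrite {2}gmn ltNge => /negP; apply.
    apply: le_trans (gP _ _) _; apply: le_trans (sle _ _ mn) _.
    exact: (stepP _).1.
  move=> m n /= gmn; case: (ltngtP m n) => // /lt; first by move/(_ gmn).
  by move/(_ (esym gmn)).
(* As [s n <= 1 / 2], squaring an entry bounded by [s n] keeps it below [s n]. *)
apply: le_trans (s2 n); have := gP (s n) y; have := rnorm_ge0 (coef U (g (s n)) y).
have : (s n)%:num <= 1 / 2 by exact: (sle 0%N).
set a := rnorm _; set b := _%:num => b1 a0 ab.
rewrite expr2; nra.
Qed.

(** Let [A] be a finite set carrying more than [||u||^2 - d]; a further coordinate of square at
    least [d] would exceed the total. *)
Lemma ell2_vanish (u : ell2 R Y) (d : R) : 0 < d ->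
  exists2 B : set Y, finite_set B & forall y, ~ B y -> rnorm (u y) ^+ 2 < d.
Proof.
move=> d0.
have : ((ell2_norm u ^+ 2 - d)%:E < sqsum u)%E.
  by rewrite -ell2_normK lte_fin ltrBlDr ltrDl.
case/ereal_sup_gt => _ [A [fA _] <-]; rewrite fsbig_finite//= sumEFin lte_fin => hA.
exists A => // y Ay.
have yA : y \notin fset_set A by rewrite in_fset_set//; apply/negP; rewrite inE.
have := finsqsum_le u (y |` fset_set A)%fset.
by rewrite big_fsetU1//=; lra.
Qed.

Lemma restrict_rnorm (A : set X) (u : ell2 R X) :
  ((rnorm (restrict_op R A u) ^+ 2)%:E = \esum_(x in A) (rnorm (u x) ^+ 2)%:E)%E.
Proof.
rewrite (ell2_normK (restrict_op R A u)) [RHS]esum_mkcond /sqsum.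
apply: eq_esum => x _; rewrite restrict_opE.
by case: asboolP => Ax; [rewrite mem_set|rewrite memNset ?rnorm0 ?expr0n].
Qed.

(** The entry at [(y, y')] is [<P V delta_y, P V delta_y'>], and [||P V delta_y||^2] is the sum over
    [n] of the squared entries of [U] at [(x n, y)]. The tail is small uniformly in [y]; the
    finitely many remaining terms are small for [y] outside a finite set. *)
Lemma restrict_ghost U V (x : nat -> X) : is_adjoint U V -> injective x ->
  (forall n y, rnorm (coef U (x n) y) ^+ 2 <= 1 / (2 ^ n.+1)%:R) ->
  forall e : R, 0 < e -> exists2 B : set Y, finite_set B &
    forall y y', ~ B y -> ~ B y' ->
      rnorm (coef (op_comp (op_comp U (restrict_op R (range x))) V) y y') < e.
Proof.
move=> UV xinj xU e e0; set P := restrict_op R _.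
have [N N2] : exists N : nat, 1 / 2 ^+ N < e / 2.
  have e2 : 0 < e / 2 by rewrite divr_gt0.
  have [N _ h] := near_infty_natSinv_expn_lt (PosNum e2).
  by exists N; apply: h => /=.
(* The [N] leading terms then add up to at most [e / 2]; the successor keeps the denominator nonzero
   when [N = 0]. *)
pose d := e / (2 * N.+1%:R).
have d0 : 0 < d by rewrite divr_gt0// mulr_gt0.
have /choice[B BP] n : exists B : set Y, finite_set B /\
    forall y, ~ B y -> rnorm (coef U (x n) y) ^+ 2 < d.
  have [B fB h] := ell2_vanish (U (ell2_delta R (x n))) d0.
  by exists B; split => // y /h; rewrite coef_applyE.
have key y : ~ (\bigcup_(n in `I_N) B n) y -> rnorm (P (V (ell2_delta R y))) ^+ 2 < e.
  move=> yB; rewrite -lte_fin restrict_rnorm.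
  rewrite esum_image; last by move=> i j _ _; exact: xinj.
  rewrite -nneseries_esumT; last by move=> n; rewrite lee_fin sqr_ge0.
  have VE n : V (ell2_delta R y) (x n) = (coef U (x n) y)^*.
    by rewrite -coef_applyE (coef_adjoint _ _ UV).
  rewrite (nneseries_split 0 N); last by move=> n _; rewrite lee_fin sqr_ge0.
  rewrite add0n -nneseries_addn; last by move=> n; rewrite lee_fin sqr_ge0.
  have cJ a : rnorm (a^* : R[i]) = rnorm a by rewrite /rnorm norm_conjC.
  apply: (@le_lt_trans _ _ ((N%:R * d)%:E + (1 / 2 ^+ N)%:E)%E).
    apply: leeD.
      rewrite sumEFin lee_fin -[N in N%:R]subn0 -sumr_const_nat mulr_suml.
      rewrite big_nat [leRHS]big_nat; apply: ler_sum => n /andP[_ nN].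
      rewrite VE cJ mul1r ltW//; apply: (BP n).2 => Bn; apply: yB.
      by exists n.
    (* The term of index [N + n] is at most [2^-N * 2^-(n+1)], and the tail sums to at most
       [2^-N]. *)
    apply: le_trans (epsilon_trick0 xpredT _); last by rewrite divr_ge0// exprn_ge0.
    apply: lee_nneseries => [n _ _|n _]; rewrite lee_fin ?sqr_ge0//.
    rewrite VE cJ; apply: le_trans (xU _ _) _.
    by rewrite -addSn expnD natrM invfM (natrX _ _ N) !mul1r mulrC.
  rewrite -EFinD lte_fin.
  have : N%:R * d <= e / 2.
    rewrite /d mulrA ler_pdivrMr ?mulr_gt0//.
    rewrite mulrA divfK//; rewrite mulrC ler_wpM2l ?(ltW e0)// ler_nat //.
  move: N2; lra.
exists (\bigcup_(n in `I_N) B n).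
  by apply: bigcup_finite => [|n _]; [exact: finite_II|have [] := BP n].
move=> y y' /key ky /key ky'.
have -> : coef (op_comp (op_comp U P) V) y y' =
    ell2_dot (P (V (ell2_delta R y))) (P (V (ell2_delta R y'))).
  have PP w : P (P w) = P w by rewrite -op_compE restrict_op_comp.
  by rewrite /coef !op_compE UV -{1}PP restrict_op_adj.
apply: (@le_lt_trans _ _ (rnorm (P (V (ell2_delta R y))) * rnorm (P (V (ell2_delta R y'))))).
  by rewrite -lecR rmorphM /= -!normE ell2_CS.
rewrite -(@ltr_pXn2r _ 2) ?nnegrE ?mulr_ge0 ?rnorm_ge0 ?(ltW e0)//.
by rewrite exprMn [e ^+ 2]expr2 ltr_pM ?sqr_ge0.
Qed.

(** The vectors [delta_(x n)] are fixed by the projection and pairwise at squared distance 2, so no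
    point is a cluster point: two of them within 1/2 of it would be at distance below 1. *)
Lemma restrict_not_compact (x : nat -> X) : injective x ->
  ~ compact_op (restrict_op R (range x)).
Proof.
move=> xinj; rewrite /compact_op precompactE => cK.
pose d n := ell2_delta R (x n).
have dK n : closure (restrict_op R (range x) @` [set v | `|v| <= 1]) (d n).
  apply: subset_closure; exists (d n); first by rewrite /= norm_delta.
  by apply: restrict_op_delta; exists n.
have [|p [_ cp]] := cK (d @ \oo) _; first by exists 0%N => // n _; exact: dK.
have h2 : 0 < 2^-1 :> R[i] by rewrite invr_gt0.
have near_p N : exists2 n, (N <= n)%N & `|p - d n| < 2^-1.
  have [|_ [[n Nn <-] pn]] := cp [set d n | n in [set n | (N <= n)%N]] _ _ (nbhsx_ballx p _ h2).
    by exists N => // n Nn; exists n.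
  by exists n => //; move: pn; rewrite -ball_normE.
have [n _ pn] := near_p 0%N; have [m nm pm] := near_p n.+1.
have dd : `|d m - d n| < 1.
  have -> : d m - d n = (p - d n) - (p - d m) by rewrite opprB [RHS]addrC addrA subrK.
  apply: le_lt_trans (ler_normB _ _) _.
  by rewrite [ltRHS](_ : 1 = 2^-1 + 2^-1) ?ltrD//; field.
have mn : x m == x n = false.
  by apply/negP => /eqP/xinj mn; rewrite mn ltnn in nm.
have : `|d m - d n| ^+ 2 < 1 by rewrite expr_lt1.
rewrite -ell2_dotuu ell2_dotBl !ell2_dotBr !delta_orthonormal !eqxx (eq_sym (x n)) mn.
by rewrite subr0 sub0r opprK -(natrD _ 1 1) ltrn1.
Qed.

End small_columns.

(** * The two infima and the alternatives they yield *)

Theorem theorem6p2 (R : realType) (X Y : choiceType)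
    (E : coarseStructure X) (F : coarseStructure Y)
    (Phi : endOp R X -> endOp R Y) :
  uniformly_locally_finite E ->
  uniformly_locally_finite F ->
  star_isomorphism (uniform_roe E) (uniform_roe F) Phi ->
  ~ rigidly_implemented E Phi ->
  (exists P : endOp R X,
     [/\ ell_infty P, is_projection P, ~ compact_op P & is_ghost F (Phi P)]) \/
  (exists P : endOp R Y,
     [/\ ell_infty P, is_projection P, ~ compact_op P &
         is_ghost E ('pinv_(fun=> 0) (uniform_roe E) Phi P)]).
Proof.
move=> _ _ iso not_rigid.
have [U [V [[UV VU1 UV1] PhiE]]] := star_iso_unitary iso.
have [infU|/(small_columns VU1)[x xinj xU]] := EM (0 < ereal_inf
    [set ereal_sup [set (rnorm (coef U x y))%:E | y in [set: Y]] | x in [set: X]])%E.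
- have [infV|/(small_columns UV1)[y yinj yV]] := EM (0 < ereal_inf
    [set ereal_sup [set (rnorm (coef V y x))%:E | x in [set: X]] | y in [set: Y]])%E.
    (* With both infima positive, [U] itself would implement [Phi] rigidly. *)
    by exfalso; apply: not_rigid; exists U, V.
  right; exists (restrict_op R (range y)); split.
  + exact: restrict_op_ell_infty.
  + exact: restrict_op_projection.
  + exact: restrict_not_compact.
  + have [_ inj sur] := star_iso_bij iso.
    (* The projection lies in the image of [Phi], so the partial inverse returns the true preimage
       [S] and not its default value 0. *)
    have [S ES PS] := sur _ (@uniform_roe_restrict R Y F (range y)).
    have -> : 'pinv_(fun=> 0) (uniform_roe E) Phi (restrict_op R (range y)) = S.
      by rewrite -PS pinvKV ?inE.
    have SE : S = op_comp (op_comp V (restrict_op R (range y))) U.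
      rewrite -PS (PhiE S ES); apply/val_inj/funext => v /=.
      have VUE w : V (U w) = w by rewrite -op_compE VU1.
      by rewrite !VUE.
    split=> //; rewrite SE.
    exact: restrict_ghost (is_adjoint_sym UV) yinj yV.
left; exists (restrict_op R (range x)); split.
- exact: restrict_op_ell_infty.
- exact: restrict_op_projection.
- exact: restrict_not_compact.
- have EP := @uniform_roe_restrict R X E (range x).
  split; first exact: (star_iso_mem iso).
  by rewrite (PhiE _ EP); exact: restrict_ghost UV xinj xU.
Qed.
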